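(* Let $A\in\mathbb{C}^{n\times n}$ be Hermitian, and let $\mathcal{X},\mathcal{Y}\subseteq\mathbb{C}^n$ be subspaces of the same dimension $k$, with orthonormal bases given by the columns of $X,Y\in\mathbb{C}^{n\times k}$ respectively, and suppose $\mathcal{X}$ or $\mathcal{Y}$ is $A$-invariant. Then $$|\lambda(X^HAX)-\lambda(Y^HAY)|\ \prec_w\ \mathrm{spr}(A)\Big[e-\cos\theta(\mathcal{X},\mathcal{Y})+\tfrac12\sin^2\theta(\mathcal{X},\mathcal{Y})\Big],$$ where $e=(1,\dots,1)^T\in\mathbb{R}^k$.
   Context: For a Hermitian matrix $M$, $\lambda(M)$ denotes the vector of its eigenvalues arranged in nonincreasing order, $\lambda_i(M)$ its $i$-th entry; for $A\in\mathbb{C}^{n\times n}$ Hermitian, $\mathrm{spr}(A)=\lambda_1(A)-\lambda_n(A)$. For any matrix $B$, $s(B)$ is the vector of singular values in nonincreasing order, and $s^{\uparrow}(B)$ the same in nondecreasing order. For subspaces $\mathcal{X},\mathcal{Y}$ of equal dimension $k$ with orthonormal-column basis matrices $X,Y$, the vector of principal angles $\theta(\mathcal{X},\mathcal{Y})\in[0,\pi/2]^k$ is arranged in nonincreasing order and defined by $\cos\theta(\mathcal{X},\mathcal{Y})=s^{\uparrow}(X^HY)$. Functions such as $\sin^2$, $\cos$, $|\cdot|$ act componentwise on vectors. For $x\in\mathbb{R}^k$, $x^{\downarrow}$ is $x$ rearranged in nonincreasing order; $x\prec_w y$ (weak submajorization) means $\sum_{i=1}^j x_i^{\downarrow}\le\sum_{i=1}^j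 y_i^{\downarrow}$ for all $1\le j\le k$. *)

(* Defs.v *)
From HB Require Import structures.
From mathcomp Require Import all_boot all_order all_algebra.
From mathcomp Require Import complex.
From mathcomp Require Import reals trigo.
Set Implicit Arguments. Unset Strict Implicit. Unset Printing Implicit Defensive.
Import Order.TTheory GRing.Theory Num.Theory.
Local Open Scope ring_scope.

Section Defs.
Variable R : realType.
Local Notation C := R[i].

Definition ctmx (m n : nat) (M : 'M[C]_(m, n)) : 'M[C]_(n, m) :=
  (map_mx (@conjc R) M)^T.

Definition hermitian_mx (n : nat) (A : 'M[C]_n) : Prop := ctmx A = A.

Definition orthonormal_cols (n k : nat) (X : 'M[C]_(n, k)) : Prop :=
  ctmx X *m X = 1%:M.

(* the column space of X is A-invariant: A (range X) is contained in range X
   (column spaces expressed as row spaces of the transposes) *)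
Definition colspace_invariant (n k : nat) (A : 'M[C]_n) (X : 'M[C]_(n, k)) : Prop :=
  ((A *m X)^T <= X^T)%MS.

Definition is_eigvals (n : nat) (M : 'M[C]_n) (l : seq R) : Prop :=
  [/\ size l = n, sorted >=%R l &
      char_poly M = \prod_(x <- l) ('X - (x%:C)%C%:P)].

Definition is_singvals (k : nat) (B : 'M[C]_k) (s : seq R) : Prop :=
  [/\ size s = k, sorted >=%R s, all (fun x => 0 <= x) s &
      char_poly (ctmx B *m B) = \prod_(x <- s) ('X - ((x ^+ 2)%:C)%C%:P)].

(* spread of A from its eigenvalue vector lambda(A) (nonincreasing) *)
Definition spr (l : seq R) : R := head 0 l - last 0 l.

(* principal angles from s(X^H Y): cos theta = s^up(X^H Y); theta is then
   nonincreasing *)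
Definition principal_angles (s : seq R) : seq R := map acos (rev s).

Definition sort_down (x : seq R) : seq R := sort >=%R x.

(* weak submajorization x <_w y for vectors of the same length k *)
Definition weak_submaj (x y : seq R) : Prop :=
  forall j : nat, (j <= size x)%N ->
    \sum_(i < j) nth 0 (sort_down x) i <= \sum_(i < j) nth 0 (sort_down y) i.

End Defs.

(* Main.v *)
Require Import Defs.
From HB Require Import structures.
From mathcomp Require Import all_boot all_order all_algebra.
From mathcomp Require Import complex.
From mathcomp Require Import reals trigo.
From mathcomp Require Import perm spectral sesquilinear ring lra.
Import Order.TTheory GRing.Theory Num.Theory.
Set Implicit Arguments. Unset Strict Implicit. Unset Printing Implicit Defensive.
Local Open Scope ring_scope.

(** Say X is A-invariant. After a singular value decomposition X^H Y = C is
    diagonal with entries c = cos theta, and after a shift |A| <= m := spr A / 2.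
    With A X = X A1 and S = Y - X C one has S^H S = 1 - C^2 and
      D := A1 - Y^H A Y
         = ((1 - C) A1 (1 + C) + (1 + C) A1 (1 - C)) / 2 - S^H A S.
    The Lidskii-Mirsky theorem bounds the sum of the j largest differences of
    eigenvalues of A1 and Y^H A Y by the sum of the j largest |u_i^H D u_i|, the
    u_i being the eigenvectors of D. Expanding in the basis where C is diagonal,
    this is at most 2 m sum_l (1 - c_l) w_l + m sum_l (1 - c_l^2) w'_l for weights
    w, w' in [0, 1] of total mass at most j, hence at most its value at the j
    smallest c_l. *)

(** * Conjugate transposes, real diagonal matrices and quadratic forms *)

Section ConjugateTranspose.
Variable R : realType.
Local Notation C := R[i].

Lemma ctmxE m n (M : 'M[C]_(m, n)) i j : ctmx M i j = conjc (M j i).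
Proof. by rewrite !mxE. Qed.

Lemma ctmxK m n (M : 'M[C]_(m, n)) : ctmx (ctmx M) = M.
Proof. by apply/matrixP=> i j; rewrite !ctmxE conjcK. Qed.

Lemma ctmxM m n p (M : 'M[C]_(m, n)) (N : 'M[C]_(n, p)) :
  ctmx (M *m N) = ctmx N *m ctmx M.
Proof. by rewrite /ctmx map_mxM trmx_mul. Qed.

Lemma ctmxD m n (M N : 'M[C]_(m, n)) : ctmx (M + N) = ctmx M + ctmx N.
Proof. by apply/matrixP=> i j; rewrite !mxE rmorphD. Qed.

Lemma ctmxB m n (M N : 'M[C]_(m, n)) : ctmx (M - N) = ctmx M - ctmx N.
Proof. by apply/matrixP=> i j; rewrite !mxE rmorphB. Qed.

Lemma ctmx1 n : ctmx (1%:M : 'M[C]_n) = 1%:M.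
Proof. by rewrite /ctmx map_mx1 trmx1. Qed.

Lemma orthonormal_colsC n (U : 'M[C]_n) :
  orthonormal_cols U -> U *m ctmx U = 1%:M.
Proof. exact: mulmx1C. Qed.

Definition rdiag n (d : 'I_n -> R) : 'M[C]_n := diag_mx (\row_i (d i)%:C%C).

Lemma rdiagE n (d : 'I_n -> R) i j : rdiag d i j = (d i)%:C%C *+ (i == j).
Proof. by rewrite !mxE; case: eqP => [->|]. Qed.

Lemma eq_rdiag n (d e : 'I_n -> R) : d =1 e -> rdiag d = rdiag e.
Proof. by move=> de; apply/matrixP=> i j; rewrite !rdiagE de. Qed.

Lemma ctmx_rdiag n (d : 'I_n -> R) : ctmx (rdiag d) = rdiag d.
Proof.
apply/matrixP=> i j; rewrite ctmxE !rdiagE eq_sym.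
by case: eqP => [->|_]; rewrite ?mulr1n ?mulr0n ?conjc_real ?conjc0.
Qed.

Lemma rdiagM n (d e : 'I_n -> R) :
  rdiag d *m rdiag e = rdiag (fun i => d i * e i).
Proof.
rewrite /rdiag mulmx_diag; congr diag_mx.
by apply/matrixP=> i j; rewrite !mxE rmorphM.
Qed.

Lemma rdiagD n (d e : 'I_n -> R) :
  rdiag d + rdiag e = rdiag (fun i => d i + e i).
Proof. by apply/matrixP=> i j; rewrite mxE !rdiagE rmorphD mulrnDl. Qed.

Lemma rdiagB n (d e : 'I_n -> R) :
  rdiag d - rdiag e = rdiag (fun i => d i - e i).
Proof. by apply/matrixP=> i j; rewrite !mxE rmorphB -mulrnBl. Qed.

Lemma rdiag_cst n (a : R) : rdiag (fun=> a) = a%:C%C%:M :> 'M[C]_n.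
Proof. by apply/matrixP=> i j; rewrite rdiagE !mxE. Qed.

Lemma mxtrace_rdiag n (d : 'I_n -> R) : \tr (rdiag d) = (\sum_i d i)%:C%C.
Proof.
by rewrite mxtrace_diag rmorph_sum; apply: eq_bigr => i _; rewrite mxE.
Qed.

Definition qform n (M : 'M[C]_n) (x : 'cV[C]_n) : C := (ctmx x *m M *m x) 0 0.

(** The order of [R[i]] compares only numbers with equal imaginary parts, so the form is also
    real. *)
Definition psd n (M : 'M[C]_n) := forall x, 0 <= qform M x.

Lemma qformD n (M N : 'M[C]_n) x : qform (M + N) x = qform M x + qform N x.
Proof. by rewrite /qform mulmxDr mulmxDl mxE. Qed.

Lemma qformB n (M N : 'M[C]_n) x : qform (M - N) x = qform M x - qform N x.
Proof. by rewrite /qform mulmxBr mulmxBl !mxE. Qed.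

Lemma qform_conj n k (M : 'M[C]_n) (B : 'M[C]_(n, k)) x :
  qform (ctmx B *m M *m B) x = qform M (B *m x).
Proof. by rewrite /qform ctmxM !mulmxA. Qed.

Lemma qform_rdiag n (d : 'I_n -> R) x :
  qform (rdiag d) x = \sum_i (d i)%:C%C * `|x i 0| ^+ 2.
Proof.
rewrite /qform mul_mx_diag mxE; apply: eq_bigr => i _.
by rewrite !mxE sqr_normc; ring.
Qed.

Lemma qform1 n (x : 'cV[C]_n) : qform 1%:M x = \sum_i `|x i 0| ^+ 2.
Proof.
rewrite -[1%:M](rdiag_cst n 1) qform_rdiag.
by apply: eq_bigr => i _; rewrite mul1r.
Qed.

Lemma qform1_ge0 n (x : 'cV[C]_n) : 0 <= qform 1%:M x.
Proof. by rewrite qform1; apply: sumr_ge0 => i _; rewrite exprn_ge0. Qed.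

Lemma qform1_gt0 n (x : 'cV[C]_n) : x != 0 -> 0 < qform 1%:M x.
Proof.
move=> x0; rewrite lt_def qform1_ge0 andbT; apply: contra x0 => /eqP.
rewrite qform1 => /eqP; rewrite psumr_eq0 => [|i _]; last by rewrite exprn_ge0.
move=> /allP h; apply/eqP/matrixP=> i j; rewrite ord1 mxE.
have := h i; rewrite mem_index_enum => /(_ isT) /eqP /eqP.
by rewrite sqrf_eq0 normr_eq0 => /eqP.
Qed.

Lemma psd_conj_rdiag n k (d : 'I_n -> R) (B : 'M[C]_(n, k)) :
  (forall i, 0 <= d i) -> psd (ctmx B *m rdiag d *m B).
Proof.
move=> d0 x; rewrite qform_conj qform_rdiag; apply: sumr_ge0 => i _.
by rewrite mulr_ge0 ?exprn_ge0 // ler0c.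
Qed.

(** * Unitary diagonalization with real eigenvalues *)

Definition eigdec n (M : 'M[C]_n) (d : 'I_n -> R) :=
  exists2 U : 'M[C]_n, orthonormal_cols U & M = U *m rdiag d *m ctmx U.

Lemma eigdec_mxtrace n (M : 'M[C]_n) d : eigdec M d -> \tr M = (\sum_i d i)%:C%C.
Proof.
by case=> U Uo ->; rewrite mxtrace_mulC mulmxA Uo mul1mx mxtrace_rdiag.
Qed.

Lemma eigdec_hermitian n (M : 'M[C]_n) d : eigdec M d -> hermitian_mx M.
Proof.
by case=> U _ ->; rewrite /hermitian_mx !ctmxM ctmxK ctmx_rdiag mulmxA.
Qed.

Lemma eigdec_shift n (M : 'M[C]_n) d (a : R) :
  eigdec M d -> eigdec (M + a%:C%C%:M) (fun i => d i + a).
Proof.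
case=> U Uo ->; exists U => //.
rewrite -rdiagD mulmxDr mulmxDl rdiag_cst; congr (_ + _).
by rewrite mul_mx_scalar -scalemxAl orthonormal_colsC // scalemx1.
Qed.

Lemma eigdec_conj n (M V : 'M[C]_n) d : orthonormal_cols V ->
  eigdec M d -> eigdec (ctmx V *m M *m V) d.
Proof.
move=> Vo [U Uo ->]; exists (ctmx V *m U); last by rewrite ctmxM ctmxK !mulmxA.
rewrite /orthonormal_cols ctmxM ctmxK mulmxA -(mulmxA _ V).
by rewrite orthonormal_colsC // mulmx1.
Qed.

Lemma hermitian_eigdec n (M : 'M[C]_n) :
  hermitian_mx M -> exists d, eigdec M d.
Proof.
move=> Mh.
have Mh' : M \is hermsymmx.
  apply/is_hermitianmxP; rewrite expr0 scale1r -[LHS]Mh.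
  by apply/matrixP=> i j; rewrite !mxE.
have /orthomx_spectralP MP := hermitian_normalmx Mh'.
have Uu := spectral_unitarymx M.
have ctE (N : 'M[C]_n) : ctmx N = map_mx Num.conj N^T.
  by apply/matrixP=> i j; rewrite !mxE.
(* The spectral diagonal is complex by type but real in value, so real parts lose nothing. *)
exists (fun i => complex.Re (spectral_diag M 0 i)), (ctmx (spectralmx M)).
  by rewrite /orthonormal_cols ctmxK ctE; apply/unitarymxP.
have -> : rdiag (fun i => complex.Re (spectral_diag M 0 i)) =
          diag_mx (spectral_diag M).
  congr diag_mx; apply/rowP=> i; rewrite mxE RRe_real //.
  by have /mxOverP := hermitian_spectral_diag_real Mh'; apply.
by rewrite ctmxK; apply: etrans MP _; rewrite ctE (invmx_unitary Uu).
Qed.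

Lemma char_poly_eigdec n (M : 'M[C]_n) d : eigdec M d ->
  char_poly M = \prod_i ('X - (d i)%:C%C%:P).
Proof.
case=> U Uo ->; have UU := orthonormal_colsC Uo.
rewrite -[RHS](_ : char_poly (rdiag d) = _); last first.
  rewrite char_poly_trig ?diag_mx_is_trig //.
  by apply: eq_bigr => i _; rewrite rdiagE eqxx.
rewrite /char_poly /char_poly_mx !map_mxM /=.
have XE : 'X%:M = map_mx polyC U *m 'X%:M *m map_mx polyC (ctmx U) :> 'M_n.
  by rewrite mul_mx_scalar -scalemxAl -map_mxM UU map_mx1 scalemx1.
rewrite {1}XE -mulmxBl -mulmxBr !det_mulmx mulrC mulrA -det_mulmx -map_mxM Uo.
by rewrite map_mx1 det1 mul1r.
Qed.

(** By unique factorization the two lists of roots differ by a permutation [s]; permuting the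
    eigenvectors by [s] realizes the prescribed order. *)
Lemma eigdec_char_poly n (M : 'M[C]_n) (d : 'I_n -> R) : hermitian_mx M ->
  char_poly M = \prod_i ('X - (d i)%:C%C%:P) -> eigdec M d.
Proof.
move=> /hermitian_eigdec [e Me]; rewrite (char_poly_eigdec Me) => /esym eE.
have /tuple_permP [s sE] : perm_eq [tuple d i | i < n] [tuple e i | i < n].
  apply/(perm_map_inj (@complexI R))/prod_XsubC_eq.
  by rewrite !big_map /= -enumT !big_enum.
have {sE} dE i : d i = e (s i).
  have := congr1 (fun l => nth 0 l i) sE.
  rewrite -[LHS](tnth_nth 0 [tuple d i | i < n]).
  rewrite -[X in _ = X](tnth_nth 0 [tuple tnth [tuple e i0 | i0 < n] (s i0) | i0 < n]).
  by rewrite !tnth_mktuple.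
case: Me => U Uo ->; exists (col_perm s U); last first.
  apply/matrixP=> i j; rewrite !mul_mx_diag !mxE.
  rewrite (reindex_inj (@perm_inj _ s)) /=; apply: eq_bigr => l _.
  by rewrite !mxE dE.
apply/matrixP=> i j; rewrite !mxE; have /matrixP/(_ (s i) (s j)) := Uo.
rewrite !mxE (inj_eq (@perm_inj _ s)) => <-.
by apply: eq_bigr => l _; rewrite !mxE.
Qed.

(** Kept apart from [eigdec], so that eigenvalues may be listed in any order until Weyl's inequality
    compares them by rank. *)
Definition nonincr n (d : 'I_n -> R) := forall i j : 'I_n, (i <= j)%N -> d j <= d i.

Lemma sorted_nonincr n (l : seq R) : size l = n -> sorted >=%R l ->
  nonincr (fun i : 'I_n => l`_i).
Proof.
move=> ln ls i j ij.
have := @sorted_leq_nth _ (>=%R) ge_trans (@lexx _ R) 0 l ls i j.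
by rewrite !inE ln !ltn_ord => /(_ isT isT ij).
Qed.

Lemma is_eigvals_eigdec n (M : 'M[C]_n) l : hermitian_mx M -> is_eigvals M l ->
  nonincr (fun i : 'I_n => l`_i) /\ eigdec M (fun i => l`_i).
Proof.
move=> Mh [ls lsort lM]; split; first exact: sorted_nonincr.
by apply: eigdec_char_poly; rewrite // lM (big_nth 0) ls big_mkord.
Qed.

Lemma hermitian_eigvals n (M : 'M[C]_n) : hermitian_mx M ->
  exists2 d, nonincr d & eigdec M d.
Proof.
move=> Mh; have [d Md] := hermitian_eigdec Mh.
pose l := sort >=%R [seq d i | i <- enum 'I_n].
have [] // := @is_eigvals_eigdec n M l Mh; last by move=> ? ?; eexists; eauto.
split; first by rewrite size_sort size_map size_enum_ord.
  by apply: sort_sorted => x y; exact: le_total.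
rewrite (char_poly_eigdec Md); apply/esym.
rewrite (perm_big _ (permEl (perm_sort _ _))) big_map /=.
by rewrite /index_enum -enumT.
Qed.

(** * Weyl's monotonicity of ordered eigenvalues *)

Lemma qform_eigdec n (U : 'M[C]_n) d x :
  qform (U *m rdiag d *m ctmx U) x =
  \sum_i (d i)%:C%C * `|(ctmx U *m x) i 0| ^+ 2.
Proof. by rewrite -{1}[U]ctmxK qform_conj qform_rdiag. Qed.

Lemma qform1_isometry n k (U : 'M[C]_(n, k)) x : orthonormal_cols U ->
  qform 1%:M (U *m x) = qform 1%:M x.
Proof. by move=> Uo; rewrite -qform_conj mulmx1 Uo. Qed.

(* The matrix G whose l-th row is that of W^H for l < i, of T^H for l > i and 0
   for l = i is singular; a kernel vector compares p i and q i. *)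
Lemma weyl_monotone n (P Q : 'M[C]_n) p q : psd (Q - P) ->
  nonincr p -> nonincr q -> eigdec P p -> eigdec Q q -> forall i, p i <= q i.
Proof.
move=> QP pn qn [T To PE] [W Wo QE] i.
pose G := \matrix_(l, j) (if (l < i)%N then ctmx W l j
            else if (i < l)%N then ctmx T l j else 0).
have /eqP/det0P [v v0 vG] : \det G^T = 0.
  rewrite det_tr (expand_det_row _ i) big1 // => j _.
  by rewrite mxE ltnn mul0r.
pose x : 'cV[C]_n := v^T.
have x0 : x != 0 by rewrite -trmx0 (inj_eq (can_inj (@trmxK _ _ _))).
have xG : G *m x = 0 by apply: trmx_inj; rewrite trmx_mul trmxK trmx0.
have xW (l : 'I_n) : (l < i)%N -> (ctmx W *m x) l 0 = 0.
  move=> li; transitivity ((G *m x) l 0); last by rewrite xG mxE.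
  by rewrite [LHS]mxE [RHS]mxE; apply: eq_bigr => j _; rewrite [G l j]mxE li.
have xT (l : 'I_n) : (i < l)%N -> (ctmx T *m x) l 0 = 0.
  move=> li; transitivity ((G *m x) l 0); last by rewrite xG mxE.
  rewrite [LHS]mxE [RHS]mxE; apply: eq_bigr => j _.
  by rewrite [G l j]mxE li ltnNge (ltnW li).
have isoC (U : 'M[C]_n) : orthonormal_cols U ->
    qform 1%:M x = \sum_l `|(ctmx U *m x) l 0| ^+ 2.
  move=> Uo; rewrite -qform1 qform1_isometry // /orthonormal_cols ctmxK.
  exact: orthonormal_colsC.
(* On the span of the eigenvectors of [P] of index at most [i], [P >= p i]; on that of the
   eigenvectors of [Q] of index at least [i], [Q <= q i]. The vector [x] lies in both. *)
rewrite -lecR -(ler_pM2r (qform1_gt0 x0)).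
apply: (@le_trans _ _ (qform P x)).
  rewrite (isoC T) // PE qform_eigdec mulr_sumr; apply: ler_sum => l _.
  case: (ltnP i l) => [/xT ->|li]; first by rewrite normr0 expr0n !mulr0.
  by rewrite ler_wpM2r ?exprn_ge0 // lecR pn.
apply: (@le_trans _ _ (qform Q x)); first by rewrite -subr_ge0 -qformB.
rewrite (isoC W) // QE qform_eigdec mulr_sumr; apply: ler_sum => l _.
case: (ltnP l i) => [/xW ->|li]; first by rewrite normr0 expr0n !mulr0.
by rewrite ler_wpM2r ?exprn_ge0 // lecR qn.
Qed.

End ConjugateTranspose.

(** * Spectrum of a commuted product, and two scalar inequalities *)

Lemma char_poly_mulC (F : fieldType) n (M N : 'M[F]_n) :
  char_poly (M *m N) = char_poly (N *m M).
Proof.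
pose M' := map_mx polyC M; pose N' := map_mx polyC N.
(* Two block eliminations of [B]: one gives [det B = det (X - M N)], the other
   [X^n det B = X^n det (X - N M)]. *)
pose B := block_mx 'X%:M M' N' 1%:M.
have B1 : \det B = char_poly (M *m N).
  transitivity (\det (block_mx (char_poly_mx (M *m N)) M' 0 1%:M *m
                      block_mx 1%:M 0 N' 1%:M)).
    congr (\det _); rewrite mulmx_block !(mulmx1, mul1mx, mulmx0, mul0mx, add0r).
    by rewrite /char_poly_mx map_mxM subrK.
  by rewrite det_mulmx det_ublock det_lblock !det1 !mulr1.
have B2 : 'X ^+ n * \det B = 'X ^+ n * char_poly (N *m M).
  have -> : 'X ^+ n * \det B = \det (block_mx 1%:M 0 (- N') 'X%:M *m B).
    by rewrite det_mulmx det_lblock det1 mul1r det_scalar.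
  rewrite mulmx_block !(mulmx1, mul1mx, mulmx0, mul0mx, add0r, addr0).
  rewrite mul_mx_scalar mul_scalar_mx mulNmx scalerN addNr det_ublock det_scalar.
  by rewrite /char_poly /char_poly_mx map_mxM addrC.
have Xn0 : 'X ^+ n != 0 :> {poly F} by rewrite expf_neq0 // polyX_eq0.
by apply: (mulfI Xn0); rewrite -B1.
Qed.

(** AM-GM for [x] and [y / b], which turns products of matrix entries into [b] times averages of
    squares. If [b = 0], the quotient is 0 by convention and the last hypothesis makes the left side
    vanish. *)
Lemma mulr_le_amgm (F : numFieldType) (b x y : F) :
  0 <= b -> 0 <= x -> 0 <= y -> (b = 0 -> y = 0) ->
  x * y <= b * ((x ^+ 2 + y ^+ 2 / b ^+ 2) / 2).
Proof.
move=> b0 x0 y0 by0; have [b00|bn0] := eqVneq b 0.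
  by rewrite (by0 b00) b00 mulr0 mul0r.
rewrite -subr_ge0.
have -> : b * ((x ^+ 2 + y ^+ 2 / b ^+ 2) / 2) - x * y =
          b / 2 * (x - y / b) ^+ 2 by field.
rewrite mulr_ge0 ?divr_ge0 // -realEsqr realB // ger0_real // divr_ge0 //.
Qed.

(** A fractional knapsack: mass at most [j] with unit capacities is best placed on the [j] largest
    values. The level [tau] separates these from the rest; it is the entry of index [j], or 0 if
    [j = k]. *)
Lemma sum_weighted_le (C : numDomainType) k j (e w : 'I_k -> C) : (j <= k)%N ->
  (forall i l : 'I_k, (i <= l)%N -> e l <= e i) -> (forall i, 0 <= e i) ->
  (forall i, 0 <= w i <= 1) -> \sum_i w i <= j%:R ->
  \sum_i e i * w i <= \sum_(i < k | (i < j)%N) e i.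
Proof.
move=> jk ed e0 w01 wj.
have [tau [tau0 tauL tauR]] : exists tau, [/\ 0 <= tau,
    forall l : 'I_k, (l < j)%N -> tau <= e l &
    forall l : 'I_k, (j <= l)%N -> e l <= tau].
  move: jk; rewrite leq_eqVlt => /predU1P [jk|jk].
    by exists 0; split=> // l; rewrite jk leqNgt ltn_ord.
  by exists (e (Ordinal jk)); split=> // l lj; apply: ed => //=; exact: ltnW.
rewrite [leRHS]big_mkcond /= -subr_ge0 -sumrB.
(* Replacing [e] by [tau] can only decrease each term: the factor of [e l] is nonnegative where
   [e l >= tau] and nonpositive where [e l <= tau]. *)
apply: (@le_trans _ _ (\sum_(i < k) tau * ((i < j)%N%:R - w i))).
  rewrite -mulr_sumr mulr_ge0 // sumrB subr_ge0 (le_trans wj) //.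
  rewrite -(big_mkord xpredT (fun i => (i < j)%N%:R)) (@big_cat_nat _ _ _ j) //=.
  rewrite [X in X + _](_ : _ = j%:R) ?lerDl ?sumr_ge0 //.
  rewrite (eq_big_nat _ _ (F2 := fun=> 1)) => [|i /andP[_ ->]] //.
  by rewrite sumr_const_nat subn0.
apply: ler_sum => l _; have /andP[wl0 wl1] := w01 l.
case: (ltnP l j) => lj /=.
  by rewrite -[X in _ <= X - _]mulr1 -mulrBr ler_wpM2r ?subr_ge0 ?tauL.
by rewrite !sub0r mulrN lerN2 ler_wpM2r ?tauR.
Qed.

(** * Sums of the largest entries by means of a threshold *)

Section TopSums.
Variable R : realType.

(** Induction on [j]: a maximizer of [d] outside [T] joins [T], and its value is the new threshold.
    For [j = 0] the sum of all entries is a valid threshold. *)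
Lemma exists_top_set k j (d : 'I_k -> R) : (j <= k)%N -> (forall i, 0 <= d i) ->
  exists T : {set 'I_k}, exists t : R, [/\ #|T| = j, 0 <= t,
    forall i, i \in T -> t <= d i & forall i, i \notin T -> d i <= t].
Proof.
move=> + d0; elim: j => [|j IHj] jk.
  exists set0, (\sum_i d i); split; rewrite ?cards0 ?sumr_ge0 //.
    by move=> i; rewrite inE.
  by move=> i _; rewrite (bigD1 i) //= lerDl sumr_ge0.
have [T [t [Tj t0 Tt Tn]]] := IHj (ltnW jk).
have /card_gt0P [i0] : (0 < #|~: T|)%N by rewrite cardsCs setCK Tj card_ord subn_gt0.
rewrite inE => i0T.
case: (@Order.TotalTheory.arg_maxP _ _ _ i0 (fun i => i \notin T) d i0T).
move=> i iT im.
exists (i |: T), (d i); split=> //.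
- by rewrite cardsU1 iT Tj.
- by move=> l; rewrite !inE => /orP [/eqP ->//|/Tt]; apply: le_trans; exact: Tn.
- by move=> l; rewrite !inE negb_or => /andP [_ /im].
Qed.

(** Each entry is at most [t] plus its excess over [t], and the other excesses are nonnegative. The
    right side no longer mentions the sorted order. *)
Lemma sum_sort_down_le (x : seq R) j t : (j <= size x)%N ->
  \sum_(i < j) nth 0 (sort_down x) i <= j%:R * t + \sum_(y <- x) Num.max (y - t) 0.
Proof.
move=> jx; have px : perm_eq (sort_down x) x by rewrite perm_sort.
rewrite -(perm_big _ px) /= (big_nth 0) (perm_size px) (@big_cat_nat _ _ _ j) //=.
have -> : j%:R * t = \sum_(i < j) t by rewrite sumr_const card_ord mulr_natl.
rewrite big_mkord addrA -big_split /=.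
rewrite -[leLHS]addr0 lerD ?sumr_ge0 // => [|i _]; last by rewrite le_max lexx orbT.
by apply: ler_sum => i _; rewrite -lerBlDl le_max lexx.
Qed.

End TopSums.

(** * The Lidskii-Mirsky inequality in threshold form *)

Section Lidskii.
Variable R : realType.
Local Notation C := R[i].

(* Keeping only the parts Dp, Dm of D beyond the threshold t, both P and P + D
   lie between P - Dm - t and P + Dp + t, and tr (Dp + Dm) is the right side. *)
Lemma lidskii_threshold n (P D : 'M[C]_n) p q d t : 0 <= t ->
  nonincr p -> nonincr q -> eigdec P p -> eigdec (P + D) q -> eigdec D d ->
  \sum_i Num.max (`|q i - p i| - t) 0 <= \sum_i Num.max (`|d i| - t) 0.
Proof.
move=> t0 pn qn Pp PDq [U Uo DE].
have Ph := eigdec_hermitian Pp.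
pose u i := Num.max (d i - t) 0; pose l i := Num.max (- d i - t) 0.
pose Dp := U *m rdiag u *m ctmx U; pose Dm := U *m rdiag l *m ctmx U.
have Eh e : ctmx (U *m rdiag e *m ctmx U) = U *m rdiag e *m ctmx U.
  by rewrite !ctmxM ctmxK ctmx_rdiag mulmxA.
have psdU e : (forall i, 0 <= e i) -> psd (U *m rdiag e *m ctmx U).
  by move=> e0; rewrite -{1}[U]ctmxK; apply: psd_conj_rdiag.
have tE : t%:C%C%:M = U *m rdiag (fun=> t) *m ctmx U.
  by rewrite rdiag_cst mul_mx_scalar -scalemxAl orthonormal_colsC // scalemx1.
have [q' q'n Qq'] : exists2 q', nonincr q' & eigdec (P + Dp) q'.
  by apply: hermitian_eigvals; rewrite /hermitian_mx ctmxD Eh Ph.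
have [p' p'n Pp'] : exists2 p', nonincr p' & eigdec (P - Dm) p'.
  by apply: hermitian_eigvals; rewrite /hermitian_mx ctmxB Eh Ph.
have shn e (a : R) : nonincr e -> nonincr (fun i : 'I_n => e i + a).
  by move=> en i j ij; rewrite lerD2r en.
have pq' : forall i, p i <= q' i.
  apply: weyl_monotone Pp Qq' => //; rewrite addrC addKr.
  by apply: psdU => i; rewrite le_max lexx orbT.
have pp' : forall i, p' i <= p i.
  apply: weyl_monotone Pp' Pp => //; rewrite opprB addrCA subrr addr0.
  by apply: psdU => i; rewrite le_max lexx orbT.
have UD e f : U *m rdiag e *m ctmx U + U *m rdiag f *m ctmx U =
    U *m rdiag (fun i => e i + f i) *m ctmx U.
  by rewrite -rdiagD mulmxDr mulmxDl.
have UB e f : U *m rdiag e *m ctmx U - U *m rdiag f *m ctmx U =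
    U *m rdiag (fun i => e i - f i) *m ctmx U.
  by rewrite -rdiagB mulmxBr mulmxBl.
have qq' : forall i, q i <= q' i + t.
  apply: weyl_monotone PDq (eigdec_shift t Qq') => //; last exact: shn.
  rewrite -[P + Dp + _]addrA opprD addrACA subrr add0r DE tE UD UB.
  apply: psdU => i; rewrite /u.
  by have := le_max (d i - t) (d i - t) 0; rewrite lexx /=; lra.
have p'q : forall i, p' i - t <= q i.
  apply: weyl_monotone (eigdec_shift (- t) Pp') PDq => //; last exact: shn.
  have -> : (- t)%:C%C%:M = - t%:C%C%:M :> 'M[C]_n.
    by apply/matrixP=> i j; rewrite !mxE rmorphN mulNrn.
  rewrite -[P - Dm + _]addrA -opprD opprB [_ - P]addrC addrACA subrr add0r.
  rewrite DE tE !UD; apply: psdU => i; rewrite /l.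
  by have := le_max (- d i - t) (- d i - t) 0; rewrite lexx /=; lra.
(* The gaps [q' i - p' i] add up to the trace of [Dp + Dm]. As [t >= 0], at most one of [u i] and
   [l i] is nonzero, so their sum is the excess of [|d i|]. *)
have -> : \sum_i Num.max (`|d i| - t) 0 = \sum_i (q' i - p' i).
  apply: complexI; rewrite sumrB rmorphB /= -(eigdec_mxtrace Qq').
  rewrite -(eigdec_mxtrace Pp') -raddfB opprB [Dm - P]addrC addrACA subrr add0r.
  rewrite /= raddfD /= !(mxtrace_mulC _ (ctmx U)) !mulmxA Uo !mul1mx.
  rewrite !mxtrace_rdiag -rmorphD -big_split /=; congr (_%:C)%C.
  apply: eq_bigr => i _; rewrite /u /l /Num.max.
  by case: (ger0P (d i)) => di; do !case: ifP => ?; lra.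
(* [p i] lies in [[p' i, q' i]] and [q i] in this interval widened by [t] on both sides. *)
apply: ler_sum => i _; rewrite ge_max subr_ge0.
rewrite (le_trans (pp' i) (pq' i)) andbT.
have := (pq' i, pp' i, qq' i, p'q i).
by case: (ger0P (q i - p i)) => _ [[[]]]; lra.
Qed.

End Lidskii.

(** * Singular value decomposition *)

Section SingularValues.
Variable R : realType.
Local Notation C := R[i].

(* V = W diag(1/c), with 1/0 = 0, is a partial isometry; its defect projections
   1 - V^H V and 1 - V V^H are unitarily equivalent, so V extends to a unitary. *)
Lemma unitary_completion n (W : 'M[C]_n) (c : 'I_n -> R) :
  (forall i, 0 <= c i) -> ctmx W *m W = rdiag (fun i => c i ^+ 2) ->
  exists2 U : 'M[C]_n, orthonormal_cols U & W = U *m rdiag c.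
Proof.
move=> c0 WW.
pose ic i := (c i)^-1; pose pi i : R := (c i != 0)%:R; pose npi i := 1 - pi i.
pose V := W *m rdiag ic.
have VV : ctmx V *m V = rdiag pi.
  rewrite ctmxM ctmx_rdiag mulmxA -(mulmxA _ _ W) WW !rdiagM; apply: eq_rdiag => i.
  rewrite /ic /pi; have [->|ci] := eqVneq (c i) 0; first by rewrite expr0n mulr0 mul0r.
  by rewrite /= mulr1n; field.
have Vpi : V *m rdiag pi = V.
  rewrite -mulmxA rdiagM; congr (_ *m _); apply: eq_rdiag => i; rewrite /ic /pi.
  by have [->|ci] := eqVneq (c i) 0; rewrite ?invr0 ?mulr0 ?mulr1.
(* Where [c j = 0], column [j] of [W] has norm 0, so [V] loses nothing there. *)
have WE : W = V *m rdiag c.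
  apply/matrixP=> i j; rewrite -mulmxA rdiagM mul_mx_diag !mxE /ic.
  have [cj|cj] := eqVneq (c j) 0; last by rewrite mulVf // mulr1.
  rewrite cj invr0 mul0r mulr0; have /matrixP/(_ j j) := WW.
  rewrite rdiagE eqxx cj expr0n /= mxE => /eqP; rewrite mulr1n psumr_eq0.
    move=> /allP/(_ i (mem_index_enum _)) /=.
    by rewrite ctmxE mulrC -sqr_normc sqrf_eq0 normr_eq0 => /eqP.
  by move=> l _; rewrite ctmxE mulrC mulcJ_ge0.
pose Q := V *m ctmx V.
have [T To TE] : eigdec (1%:M - Q) npi.
  have Qpi : eigdec Q pi.
    apply: eigdec_char_poly; first by rewrite /hermitian_mx ctmxM ctmxK.
    rewrite char_poly_mulC VV; apply: char_poly_eigdec; exists 1%:M.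
      by rewrite /orthonormal_cols ctmx1 mulmx1.
    by rewrite ctmx1 mulmx1 mul1mx.
  case: Qpi => T To QE; exists T => //.
  have -> : rdiag npi = 1%:M - rdiag pi.
    by rewrite -[1%:M](rdiag_cst n 1) rdiagB.
  by rewrite mulmxBr mulmxBl mulmx1 (orthonormal_colsC To) -QE.
(* [N] carries the coordinates with [c i = 0] isometrically into the orthogonal complement of the
   range of [V]; it is killed by [rdiag c], so adding it to [V] keeps the factorization of [W]. *)
pose N := T *m rdiag npi.
have NE : N = (1%:M - Q) *m T by rewrite TE -!mulmxA To mulmx1.
have npi2 : rdiag npi *m rdiag npi = rdiag npi.
  rewrite rdiagM; apply: eq_rdiag => i; rewrite /npi /pi.
  by case: eqP => _ /=; ring.
have NN : ctmx N *m N = rdiag npi.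
  by rewrite ctmxM ctmx_rdiag mulmxA -(mulmxA _ _ T) To mulmx1.
have VN : ctmx V *m N = 0.
  rewrite NE mulmxA mulmxBr mulmx1 mulmxA VV.
  by rewrite -{1}Vpi ctmxM ctmx_rdiag subrr mul0mx.
have NV : ctmx N *m V = 0.
  by rewrite -[V]ctmxK -ctmxM VN; apply/matrixP=> i j; rewrite !mxE conjc0.
have Npic : N *m rdiag c = 0.
  rewrite -mulmxA rdiagM; set Z := rdiag _; suff -> : Z = 0 by rewrite mulmx0.
  apply/matrixP=> i j; rewrite rdiagE mxE /npi /pi.
  by have [->|_] := eqVneq (c i) 0; rewrite ?mulr0 ?subrr ?mul0r mul0rn.
exists (V + N); last by rewrite mulmxDl Npic addr0.
rewrite /orthonormal_cols ctmxD mulmxDl !mulmxDr VV NN VN NV addr0 add0r rdiagD.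
by rewrite -[1%:M](rdiag_cst n 1); apply: eq_rdiag => i; rewrite /npi addrC subrK.
Qed.

(** Diagonalizing [B^H B] by [V] makes the columns of [B V] orthogonal of lengths [c]. No order is
    imposed on [c], so cosines can be listed increasingly. *)
Lemma svd n (B : 'M[C]_n) (c : 'I_n -> R) : (forall i, 0 <= c i) ->
  char_poly (ctmx B *m B) = \prod_i ('X - (c i ^+ 2)%:C%C%:P) ->
  exists U V : 'M[C]_n, [/\ orthonormal_cols U, orthonormal_cols V &
    ctmx U *m B *m V = rdiag c].
Proof.
move=> c0 Bc.
have [V Vo VE] : eigdec (ctmx B *m B) (fun i => c i ^+ 2).
  by apply: eigdec_char_poly; rewrite // /hermitian_mx ctmxM ctmxK.
have [U Uo UE] : exists2 U, orthonormal_cols U & B *m V = U *m rdiag c.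
  apply: unitary_completion => //; rewrite ctmxM mulmxA -(mulmxA _ _ B) VE.
  by rewrite !mulmxA Vo mul1mx -mulmxA Vo mulmx1.
by exists U, V; split; rewrite // -mulmxA UE mulmxA Uo mul1mx.
Qed.

End SingularValues.

(** * Operator norm bounds *)

Section NormBound.
Variable R : realType.
Local Notation C := R[i].

(** Operator norm at most [|b|], squared to avoid roots. *)
Definition normbound p q (M : 'M[C]_(p, q)) (b : R) :=
  forall x : 'cV[C]_q, qform 1%:M (M *m x) <= (b ^+ 2)%:C%C * qform 1%:M x.

Lemma normboundM p q r (M : 'M[C]_(p, q)) (N : 'M[C]_(q, r)) a b :
  normbound M a -> normbound N b -> normbound (M *m N) (a * b).
Proof.
move=> Ma Nb x; rewrite -mulmxA; apply: le_trans (Ma _) _.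
rewrite exprMn [X in _ <= X * _]rmorphM -mulrA; apply: ler_wpM2l (Nb x).
by rewrite ler0c sqr_ge0.
Qed.

Lemma normbound_rdiag n (d : 'I_n -> R) b :
  (forall i, `|d i| <= b) -> normbound (rdiag d) b.
Proof.
move=> db x; rewrite -qform_conj mulmx1 ctmx_rdiag rdiagM qform_rdiag qform1.
rewrite mulr_sumr; apply: ler_sum => i _; rewrite ler_wpM2r ?exprn_ge0 // lecR.
have b0 : 0 <= b := le_trans (normr_ge0 _) (db i).
by rewrite -expr2 -[d i ^+ 2]real_normK ?num_real // ler_sqr ?nnegrE.
Qed.

Lemma normbound_isometry p q (U : 'M[C]_(p, q)) :
  orthonormal_cols U -> normbound U 1.
Proof. by move=> Uo x; rewrite qform1_isometry // expr1n mul1r. Qed.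

(** [P = 1 - U U^H] is a Hermitian projection, so its form at [x] is the squared norm of [P x]. *)
Lemma normbound_coisometry p q (U : 'M[C]_(p, q)) :
  orthonormal_cols U -> normbound (ctmx U) 1.
Proof.
move=> Uo x; rewrite expr1n mul1r -qform_conj ctmxK mulmx1 -subr_ge0 -qformB.
pose P := 1%:M - U *m ctmx U.
have Ph : ctmx P = P by rewrite ctmxB ctmx1 ctmxM ctmxK.
have PE : P = ctmx P *m 1%:M *m P.
  rewrite Ph mulmx1 {2}/P mulmxBl mul1mx mulmxBr mulmx1 -!mulmxA.
  by rewrite (mulmxA _ U) Uo mul1mx subrr subr0.
by rewrite -/P PE qform_conj qform1_ge0.
Qed.

(** Used for a matrix and its conjugate transpose, it makes the squared moduli of the entries of a
    contraction doubly substochastic. *)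
Lemma normbound_col p q (M : 'M[C]_(p, q)) b i : normbound M b ->
  \sum_l `|M l i| ^+ 2 <= (b ^+ 2)%:C%C.
Proof.
move=> /(_ (delta_mx i 0)); rewrite -colE !qform1.
rewrite (bigD1 i) //= [X in _ + X]big1 => [|l li]; last first.
  by rewrite mxE (negbTE li) normr0 expr0n.
rewrite mxE !eqxx normr1 expr1n addr0 mulr1; apply: le_trans.
by apply: ler_sum => l _; rewrite mxE.
Qed.

Lemma normbound_eigdec n (A : 'M[C]_n) a b : eigdec A a ->
  (forall i, `|a i| <= b) -> normbound A b.
Proof.
case=> U Uo -> ab; rewrite -[b]mulr1 -[X in X * 1]mul1r.
apply: normboundM; last exact: normbound_coisometry.
by apply: normboundM (normbound_rdiag ab); exact: normbound_isometry.
Qed.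

Lemma normr_qform_eigdec n (A : 'M[C]_n) a b x : eigdec A a ->
  (forall i, `|a i| <= b) -> `|qform A x| <= b%:C%C * qform 1%:M x.
Proof.
case=> U Uo -> ab; rewrite qform_eigdec (le_trans (ler_norm_sum _ _ _)) //.
have <- : qform 1%:M (ctmx U *m x) = qform 1%:M x.
  by rewrite qform1_isometry // /orthonormal_cols ctmxK orthonormal_colsC.
rewrite qform1 mulr_sumr; apply: ler_sum => i _.
rewrite normrM [`|_ ^+ 2|]ger0_norm ?exprn_ge0 //.
rewrite ler_wpM2r ?exprn_ge0 // normc_def /= expr0n addr0 sqrtr_sqr lecR.
exact: ab.
Qed.

End NormBound.

(** * The difference of two compressions and its Ky Fan sums *)

Section CompressionDifference.
Variables (R : realType) (n k : nat).
Local Notation C := R[i].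

(** [Y = X C + S] with [X^H S = 0]. Invariance removes the cross terms, leaving
    [Y^H A Y = C A1 C + S^H A S]. Doubling avoids halves. *)
Lemma compression_difference (A : 'M[C]_n) (X Y : 'M[C]_(n, k)) A1 (c : 'I_k -> R) :
  hermitian_mx A -> orthonormal_cols X -> orthonormal_cols Y ->
  ctmx X *m Y = rdiag c -> A *m X = X *m A1 ->
  let S := Y - X *m rdiag c in
  let Z := rdiag (fun l => 1 - c l) *m A1 *m rdiag (fun l => 1 + c l) in
  [/\ ctmx S *m S = rdiag (fun l => 1 - c l ^+ 2) &
  (A1 - ctmx Y *m A *m Y) *+ 2 = Z + ctmx Z - (ctmx S *m A *m S) *+ 2].
Proof.
move=> Ah Xo Yo XY AX S Z.
have A1E : A1 = ctmx X *m A *m X by rewrite -mulmxA AX mulmxA Xo mul1mx.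
have A1h : ctmx A1 = A1 by rewrite A1E !ctmxM ctmxK Ah mulmxA.
have YX : ctmx Y *m X = rdiag c by rewrite -[X]ctmxK -ctmxM XY ctmx_rdiag.
have XA : ctmx X *m A = A1 *m ctmx X.
  by rewrite -[LHS]ctmxK ctmxM ctmxK Ah AX ctmxM A1h.
have XS : ctmx X *m S = 0 by rewrite mulmxBr XY mulmxA Xo mul1mx subrr.
have SX : ctmx S *m X = 0.
  by rewrite -[X]ctmxK -ctmxM XS; apply/matrixP=> i j; rewrite !mxE conjc0.
have YE : Y = X *m rdiag c + S by rewrite addrC subrK.
split.
  rewrite {2}/S mulmxBr mulmxA SX mul0mx subr0 ctmxB mulmxBl Yo ctmxM ctmx_rdiag.
  rewrite -mulmxA XY rdiagM -[1%:M](rdiag_cst k 1) rdiagB.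
  by apply: eq_rdiag => l; rewrite expr2.
have -> : ctmx Y *m A *m Y = rdiag c *m A1 *m rdiag c + ctmx S *m A *m S.
  rewrite {2}YE mulmxDr; congr (_ + _).
    by rewrite mulmxA -(mulmxA _ A) AX mulmxA YX.
  rewrite {1}YE ctmxD ctmxM ctmx_rdiag !mulmxDl -(mulmxA _ (ctmx X)) XA.
  by rewrite -!mulmxA XS !mulmx0 add0r.
rewrite opprD addrA mulrnBl; congr (_ - _).
(* Entrywise, [(1 - c_i)(1 + c_j) + (1 + c_i)(1 - c_j) = 2 (1 - c_i c_j)]. *)
apply/matrixP=> i j; rewrite /Z !ctmxM !ctmx_rdiag A1h.
rewrite mulr2n /rdiag !(mul_mx_diag, mul_diag_mx) !mxE.
by rewrite !rmorphD !rmorphN !rmorph1; ring.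
Qed.

Lemma ky_fan_compression_difference (A : 'M[C]_n) (X Y : 'M[C]_(n, k)) A1
    (a : 'I_n -> R) (c d : 'I_k -> R) m (T : {set 'I_k}) :
  orthonormal_cols X -> orthonormal_cols Y ->
  ctmx X *m Y = rdiag c -> A *m X = X *m A1 ->
  eigdec A a -> (forall i, `|a i| <= m) -> 0 <= m ->
  (forall l, 0 <= c l <= 1) -> (forall i l : 'I_k, (i <= l)%N -> c i <= c l) ->
  eigdec (A1 - ctmx Y *m A *m Y) d ->
  \sum_(i in T) `|d i| <=
  \sum_(l < k | (l < #|T|)%N) m * (2 * (1 - c l) + (1 - c l ^+ 2)).
Proof.
move=> Xo Yo XY AX Aa am m0 c01 cinc [U Uo DE].
have Ah := eigdec_hermitian Aa.
have [] := compression_difference Ah Xo Yo XY AX.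
set S := Y - _; set E := rdiag (fun l => 1 - c l); set F := rdiag (fun l => 1 + c l).
move=> SS DZ; set D := A1 - _ in DE DZ.
have A1E : A1 = ctmx X *m A *m X by rewrite -mulmxA AX mulmxA Xo mul1mx.
(* [b] bounds the norm of [N], since [|A1| <= m] and [|F| <= 2]. *)
pose b := 2 * m; have b0 : 0 <= b by rewrite mulr_ge0.
pose N := A1 *m F *m U.
have A1m : normbound A1 m.
  rewrite A1E -[m]mulr1 -[X in X * 1]mul1r.
  apply: normboundM; last exact: normbound_isometry.
  apply: normboundM (normbound_eigdec Aa am); exact: normbound_coisometry.
have F2 : normbound F 2.
  apply: normbound_rdiag => l; have /andP[cl0 cl1] := c01 l.
  by rewrite ger0_norm; lra.
have Nb : normbound N b.
  rewrite /b mulrC -[_ * _]mulr1; apply: normboundM (normbound_isometry Uo).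
  exact: normboundM.
have NCb : normbound (ctmx N) b.
  rewrite !ctmxM ctmx_rdiag A1E !ctmxM ctmxK Ah (mulmxA _ A) -A1E -[b]mul1r.
  by apply: normboundM; [exact: normbound_coisometry | exact: normboundM].
have colU i : \sum_l `|U l i| ^+ 2 <= 1.
  by have := normbound_col i (normbound_isometry Uo); rewrite expr1n.
have rowU l : \sum_i `|U l i| ^+ 2 <= 1.
  have := normbound_col l (normbound_coisometry Uo); rewrite expr1n.
  by under eq_bigr do rewrite ctmxE normcJ.
have colN i : \sum_l `|N l i| ^+ 2 <= (b ^+ 2)%:C%C := normbound_col i Nb.
have rowN l : \sum_i `|N l i| ^+ 2 <= (b ^+ 2)%:C%C.
  by have := normbound_col l NCb; under eq_bigr do rewrite ctmxE normcJ.
have N0 l i : b%:C%C = 0 -> `|N l i| = 0.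
  case=> b00; have := colN i; rewrite b00 expr0n (bigD1 l) //= => Nle.
  have {}Nle : `|N l i| ^+ 2 <= 0.
    by apply: le_trans Nle; rewrite lerDl sumr_ge0 // => j _; rewrite exprn_ge0.
  apply/eqP; rewrite -sqrf_eq0 eq_le Nle exprn_ge0 //.
(* The triangle inequality in the doubled identity at the eigenvector [u]: [z] and its conjugate
   have equal modulus, and expanding [z] pairs [U] with [N]. *)
have dle i : `|d i|%:C%C <= \sum_l (1 - c l)%:C%C * (`|U l i| * `|N l i|) +
    m%:C%C * \sum_l (1 - c l ^+ 2)%:C%C * `|U l i| ^+ 2.
  pose u := col i U; pose z := (ctmx u *m (E *m A1 *m F) *m u) 0 0.
  have dE : (d i)%:C%C = qform D u.
    rewrite /u colE -qform_conj DE -!mulmxA Uo mulmx1 !mulmxA Uo mul1mx.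
    rewrite qform_rdiag (bigD1 i) //= big1 => [|l li]; last first.
      by rewrite mxE (negbTE li) normr0 expr0n mulr0.
    by rewrite mxE !eqxx normr1 expr1n mulr1 addr0.
  have zE : qform D u *+ 2 = z + conjc z - qform (ctmx S *m A *m S) u *+ 2.
    rewrite mulr2n -qformD -mulr2n DZ qformB qformD; congr (_ + _ - _).
      have -> : conjc z = ctmx (ctmx u *m (E *m A1 *m F) *m u) 0 0 by rewrite ctmxE.
      by rewrite /qform [in RHS]ctmxM [in RHS]ctmxM ctmxK mulmxA.
    by rewrite [in LHS]mulr2n qformD -mulr2n.
  have zle : `|z| <= \sum_l (1 - c l)%:C%C * (`|U l i| * `|N l i|).
    rewrite /z -!mulmxA mxE (le_trans (ler_norm_sum _ _ _)) //.
    apply: ler_sum => l _; rewrite mul_diag_mx ctmxE.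
    have -> : A1 *m (F *m u) = col i N by rewrite /N /u !colE !mulmxA.
    rewrite !mxE !normrM normcJ mulrCA [`|_%:C%C|]ger0_norm //.
    by rewrite ler0c subr_ge0; case/andP: (c01 l).
  have Sle : `|qform (ctmx S *m A *m S) u| <=
      m%:C%C * \sum_l (1 - c l ^+ 2)%:C%C * `|U l i| ^+ 2.
    rewrite qform_conj (le_trans (normr_qform_eigdec _ Aa am)) //.
    rewrite -qform_conj mulmx1 SS qform_rdiag.
    by under eq_bigr do rewrite mxE.
  have -> : `|d i|%:C%C = `|(d i)%:C%C|.
    by rewrite normc_def /= expr0n addr0 sqrtr_sqr.
  rewrite dE -(ler_pMn2r (ltn0Sn 1)) -normrMn zE.
  rewrite (le_trans (ler_normB _ _)) // mulrnDl normrMn lerD ?lerMn2r //.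
  by rewrite (le_trans (ler_normD _ _)) // normcJ -mulr2n lerMn2r zle.
have inj_le j (P : 'I_k -> C) : (forall i, 0 <= P i) -> \sum_i P i <= j ->
    \sum_(i in T) P i <= j.
  move=> P0; apply: le_trans; rewrite [leLHS]big_mkcond /=.
  by apply: ler_sum => i _; case: ifP.
(* These are the weights of the two sums after AM-GM. Row sums of squares bound each weight by 1,
   column sums bound the total mass by the size of [T]. *)
pose w1 l : C := \sum_(i in T) (`|U l i| ^+ 2 + `|N l i| ^+ 2 / b%:C%C ^+ 2) / 2.
pose w2 l : C := \sum_(i in T) `|U l i| ^+ 2.
have b0C : 0 <= b%:C%C :> C by rewrite ler0c.
have term0 l i : 0 <= (`|U l i| ^+ 2 + `|N l i| ^+ 2 / b%:C%C ^+ 2) / 2 :> C.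
  by rewrite divr_ge0 // addr_ge0 ?divr_ge0 ?exprn_ge0.
have half_le (x y : C) : x <= 1 -> y <= (b ^+ 2)%:C%C ->
    (x + y / b%:C%C ^+ 2) / 2 <= 1.
  move=> x1 yb; rewrite ler_pdivrMr // mul1r -[2]/(1 + 1 : C) lerD //.
  have [->|bn0] := eqVneq b 0; first by rewrite expr0n invr0 mulr0.
  rewrite ler_pdivrMr ?mul1r -?rmorphXn //.
  by rewrite rmorphXn exprn_gt0 // lt_def b0C andbT (inj_eq (@complexI R) b 0).
have sum_half I (r : seq I) (P : pred I) (f g : I -> C) :
    \sum_(i <- r | P i) (f i + g i / b%:C%C ^+ 2) / 2 =
    (\sum_(i <- r | P i) f i + (\sum_(i <- r | P i) g i) / b%:C%C ^+ 2) / 2.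
  by rewrite -mulr_suml big_split /= mulr_suml.
have w101 l : 0 <= w1 l <= 1.
  apply/andP; split; first by apply: sumr_ge0.
  by apply: inj_le; rewrite // sum_half half_le.
have w201 l : 0 <= w2 l <= 1.
  apply/andP; split; first by apply: sumr_ge0 => i _; rewrite exprn_ge0.
  by apply: inj_le => // i; rewrite exprn_ge0.
have w1T : \sum_l w1 l <= #|T|%:R.
  rewrite exchange_big /= -sumr_const; apply: ler_sum => i _.
  by rewrite sum_half half_le.
have w2T : \sum_l w2 l <= #|T|%:R.
  by rewrite exchange_big /= -sumr_const; apply: ler_sum => i _.
have Tk : (#|T| <= k)%N by rewrite -[k in leqRHS]card_ord max_card.
have e0 l : 0 <= (1 - c l)%:C%C :> C.
  by rewrite ler0c subr_ge0; case/andP: (c01 l).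
have f0 l : 0 <= (1 - c l ^+ 2)%:C%C :> C.
  by rewrite ler0c subr_ge0; case/andP: (c01 l) => *; rewrite exprn_ile1.
rewrite -lecR rmorph_sum /=; apply: le_trans (ler_sum _ (fun i _ => dle i)) _.
rewrite big_split /= exchange_big /= -mulr_sumr [X in _ + _ * X]exchange_big /=.
apply: (@le_trans _ _ (b%:C%C * (\sum_l (1 - c l)%:C%C * w1 l) +
                       m%:C%C * (\sum_l (1 - c l ^+ 2)%:C%C * w2 l))).
  rewrite lerD //; last first.
    by rewrite ler_wpM2l ?ler0c // ler_sum // => l _; rewrite mulr_sumr.
  rewrite mulr_sumr ler_sum // => l _; rewrite -mulr_sumr mulrCA ler_wpM2l //.
  rewrite mulr_sumr ler_sum // => i _; apply: mulr_le_amgm => //.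
  by move=> /N0.
(* Both [1 - c] and [1 - c^2] are nonincreasing, so the same first indices are extremal for both
   sums. *)
apply: (@le_trans _ _ (b%:C%C * (\sum_(l < k | (l < #|T|)%N) (1 - c l)%:C%C) +
                       m%:C%C * (\sum_(l < k | (l < #|T|)%N) (1 - c l ^+ 2)%:C%C))).
  rewrite lerD // ler_wpM2l ?ler0c // sum_weighted_le // => i l il.
    by rewrite lecR lerB // cinc.
  rewrite lecR lerB // ler_sqr ?nnegrE ?cinc //.
    by case/andP: (c01 i).
  by case/andP: (c01 l).
rewrite -!rmorph_sum -!rmorphM -rmorphD lecR !mulr_sumr -big_split /=.
rewrite le_eqVlt; apply/orP; left; apply/eqP.
by apply: eq_bigr => l _; rewrite /b; ring.
Qed.

End CompressionDifference.

(** * From compressions to Ritz values *)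

Section RitzValues.
Variable R : realType.
Local Notation C := R[i].

Lemma colspace_invariantE n k (A : 'M[C]_n) (X : 'M[C]_(n, k)) :
  orthonormal_cols X -> colspace_invariant A X ->
  A *m X = X *m (ctmx X *m A *m X).
Proof.
move=> Xo /submxP [K] /(congr1 trmx); rewrite trmxK trmx_mul trmxK => AX.
by rewrite -(mulmxA _ A) AX (mulmxA _ X) Xo mul1mx.
Qed.

Lemma orthonormal_colsM n k (X : 'M[C]_(n, k)) (U : 'M[C]_k) :
  orthonormal_cols X -> orthonormal_cols U -> orthonormal_cols (X *m U).
Proof.
by move=> Xo Uo; rewrite /orthonormal_cols ctmxM mulmxA -(mulmxA _ _ X) Xo mulmx1.
Qed.

Lemma colspace_invariantM n k (A : 'M[C]_n) (X : 'M[C]_(n, k)) (U : 'M[C]_k) :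
  orthonormal_cols U -> A *m X = X *m (ctmx X *m A *m X) ->
  A *m (X *m U) = X *m U *m (ctmx (X *m U) *m A *m (X *m U)).
Proof.
move=> Uo AX; rewrite ctmxM !mulmxA -(mulmxA _ U) orthonormal_colsC // mulmx1.
by rewrite {1}AX !mulmxA.
Qed.

(** The threshold [t] is that of a top set of the [|d i|], for which [j t] plus the excesses equals
    the Ky Fan sum. The shift by [mu] cancels in the difference because [X^H X = Y^H Y = 1]. *)
Lemma ritz_value_threshold n k (A : 'M[C]_n) (X Y : 'M[C]_(n, k))
    (a : 'I_n -> R) (c p q : 'I_k -> R) mu m j :
  orthonormal_cols X -> orthonormal_cols Y -> ctmx X *m Y = rdiag c ->
  A *m X = X *m (ctmx X *m A *m X) ->
  eigdec A a -> (forall i, `|a i - mu| <= m) -> 0 <= m ->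
  (forall l, 0 <= c l <= 1) -> (forall i l : 'I_k, (i <= l)%N -> c i <= c l) ->
  nonincr p -> nonincr q ->
  eigdec (ctmx X *m A *m X) p -> eigdec (ctmx Y *m A *m Y) q -> (j <= k)%N ->
  exists t, j%:R * t + \sum_i Num.max (`|p i - q i| - t) 0 <=
    \sum_(l < k | (l < j)%N) m * (2 * (1 - c l) + (1 - c l ^+ 2)).
Proof.
move=> Xo Yo XY AX Aa am m0 c01 cinc pn qn Xp Yq jk.
pose M := (- mu)%:C%C%:M : 'M[C]_n.
have shift (Z : 'M[C]_(n, k)) : orthonormal_cols Z ->
    ctmx Z *m (A + M) *m Z = ctmx Z *m A *m Z + (- mu)%:C%C%:M.
  move=> Zo; rewrite mulmxDr mulmxDl; congr (_ + _).
  by rewrite mul_mx_scalar -scalemxAl Zo scalemx1.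
pose A1 := ctmx X *m (A + M) *m X.
have A0X : (A + M) *m X = X *m A1.
  rewrite /A1 (shift X Xo) mulmxDl mulmxDr {1}AX; congr (_ + _).
  by rewrite mul_mx_scalar mul_scalar_mx.
pose D := ctmx X *m A *m X - ctmx Y *m A *m Y.
have DE : D = A1 - ctmx Y *m (A + M) *m Y.
  by rewrite /A1 (shift X Xo) (shift Y Yo) opprD addrACA subrr addr0.
have [d Dd] : exists d, eigdec D d.
  apply: hermitian_eigdec; rewrite /hermitian_mx ctmxB.
  by congr (_ - _); [exact: eigdec_hermitian Xp | exact: eigdec_hermitian Yq].
have [T [t [Tj t0 Tin Tout]]] := exists_top_set jk (fun i => normr_ge0 (d i)).
exists t; have XE : ctmx X *m A *m X = ctmx Y *m A *m Y + D by rewrite addrC subrK.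
rewrite XE in Xp.
apply: (@le_trans _ _ (j%:R * t + \sum_i Num.max (`|d i| - t) 0)).
  by rewrite lerD2l; exact: lidskii_threshold t0 qn pn Yq Xp Dd.
have -> : j%:R * t + \sum_i Num.max (`|d i| - t) 0 = \sum_(i in T) `|d i|.
  rewrite (bigID [in T]) /= [X in _ + (_ + X)]big1 => [|i /Tout ?]; last first.
    by rewrite max_r // subr_le0.
  rewrite addr0 (eq_bigr (fun i => `|d i| - t)) => [|i /Tin ?]; last first.
    by rewrite max_l // subr_ge0.
  by rewrite sumrB sumr_const Tj mulr_natl addrC subrK.
rewrite DE in Dd; rewrite -Tj.
exact: ky_fan_compression_difference XY A0X (eigdec_shift (- mu) Aa) am _ _ _ Dd.
Qed.

(** Supplies the shift [mu] and the bound [m]: centering the spectrum brings the norm down to half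
    the spread. *)
Lemma normr_sub_mid_spr n (l : seq R) (i : 'I_n) : size l = n -> sorted >=%R l ->
  `|l`_i - (head 0 l + last 0 l) / 2| <= spr l / 2.
Proof.
move=> ln ls; have ninc := sorted_nonincr ln ls.
have n0 : (0 < n)%N := leq_ltn_trans (leq0n i) (ltn_ord i).
have n1 : (n.-1 < n)%N by rewrite prednK.
have h : l`_i <= head 0 l by rewrite -nth0; apply: (ninc (Ordinal n0)).
have t : last 0 l <= l`_i.
  rewrite -nth_last ln; apply: (ninc i (Ordinal n1)).
  by rewrite -ltnS prednK.
by rewrite /spr ler_norml; apply/andP; split; lra.
Qed.

Lemma spr_ge0 (l : seq R) : sorted >=%R l -> 0 <= spr l.
Proof.
case: (posnP (size l)) => [/size0nil -> _|l0 ls]; first by rewrite /spr subrr.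
have := normr_sub_mid_spr (Ordinal l0) erefl ls.
by move=> /(le_trans (normr_ge0 _)); lra.
Qed.

End RitzValues.

(** * Weak submajorization in terms of the principal angles *)

Theorem theorem3p3 (R : realType) (n k : nat) (A : 'M[R[i]]_n)
    (X Y : 'M[R[i]]_(n, k))
    (lA lX lY s : seq R) :
  hermitian_mx A ->
  orthonormal_cols X -> orthonormal_cols Y ->
  colspace_invariant A X \/ colspace_invariant A Y ->
  is_eigvals A lA ->
  is_eigvals (ctmx X *m A *m X) lX ->
  is_eigvals (ctmx Y *m A *m Y) lY ->
  is_singvals (ctmx X *m Y) s ->
  let theta := principal_angles s in
  weak_submaj
    [seq `|a.1 - a.2| | a <- zip lX lY]
    [seq spr lA * (1 - cos t + (sin t ^+ 2) / 2) | t <- theta].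
Proof.
move=> Ah Xo Yo inv eA eX eY [ss ssort spos sE] theta.
have [_ Aa] := is_eigvals_eigdec Ah eA.
have Zh (Z : 'M[R[i]]_(n, k)) : hermitian_mx (ctmx Z *m A *m Z).
  by rewrite /hermitian_mx !ctmxM ctmxK Ah mulmxA.
have [pn Xp] := is_eigvals_eigdec (Zh X) eX.
have [qn Yq] := is_eigvals_eigdec (Zh Y) eY.
have [[[lAn lAs _] [lXk _ _]] [lYk _ _]] := (eA, eX, eY).
pose r := rev s; pose c (i : 'I_k) := r`_i.
have rk : size r = k by rewrite size_rev.
have rsort : sorted <=%R r by rewrite rev_sorted.
have c0 i : 0 <= c i by apply: (allP spos); rewrite -mem_rev mem_nth // rk.
have cinc (i l : 'I_k) : (i <= l)%N -> c i <= c l.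
  by apply: (sorted_leq_nth le_trans lexx 0 rsort); rewrite inE rk.
(* The bases become [X U] and [Y V], so that their Gram matrix is diagonal; the eigenvalues of the
   compressions are unchanged. *)
have [U [V [Uo Vo UV]]] : exists U V : 'M_k, [/\ orthonormal_cols U,
    orthonormal_cols V & ctmx U *m (ctmx X *m Y) *m V = rdiag c].
  apply: svd => //; rewrite sE -(perm_big _ (permEl (perm_rev s))) /=.
  by rewrite (big_nth 0) rk big_mkord.
have XUo := orthonormal_colsM Xo Uo; have YVo := orthonormal_colsM Yo Vo.
have XUYV : ctmx (X *m U) *m (Y *m V) = rdiag c by rewrite ctmxM -UV !mulmxA.
have YVXU : ctmx (Y *m V) *m (X *m U) = rdiag c.
  by rewrite -[X *m U]ctmxK -ctmxM XUYV ctmx_rdiag.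
(* A cosine is a diagonal entry of a product of two contractions. *)
have c01 l : 0 <= c l <= 1.
  rewrite c0 /= -(@expr_le1 _ 2) // -lecR.
  have := normbound_col l (normboundM (normbound_coisometry XUo) (normbound_isometry YVo)).
  rewrite XUYV mulr1 expr1n; apply: le_trans.
  rewrite (bigD1 l) //= rdiagE eqxx mulr1n rmorphXn ger0_norm ?ler0c //.
  by rewrite lerDl sumr_ge0 // => i _; rewrite exprn_ge0.
have conjE (Z : 'M[R[i]]_(n, k)) W d : orthonormal_cols W ->
    eigdec (ctmx Z *m A *m Z) d -> eigdec (ctmx (Z *m W) *m A *m (Z *m W)) d.
  by move=> Wo /(eigdec_conj Wo); rewrite ctmxM !mulmxA.
have m0 : 0 <= spr lA / 2 by rewrite divr_ge0 ?spr_ge0.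
have am i := normr_sub_mid_spr i lAn lAs.
have zipk : size (zip lX lY) = k by rewrite size_zip lXk lYk minnn.
move=> j; rewrite size_map zipk => jk.
(* The bound as a function of the cosine, by [sin^2 = 1 - cos^2]. It is nonincreasing on [[0, 1]],
   so [map g r] is already sorted. *)
pose g (x : R) := spr lA * (1 - x + (1 - x ^+ 2) / 2).
have {theta} -> : [seq spr lA * (1 - cos t + (sin t ^+ 2) / 2) | t <- theta] = map g r.
  rewrite /theta /principal_angles -map_comp; apply/eq_in_map => x xr.
  have /(nthP 0) [i ik <-] : x \in r by []; rewrite rk in ik; rewrite /=.
  have /andP[ci0 ci1] := c01 (Ordinal ik); rewrite /g.
  have ci : -1 <= r`_i <= 1 by rewrite ci1 (le_trans _ ci0) // lerN10.
  rewrite acosK // sin_acos // sqr_sqrtr // subr_ge0.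
  by rewrite expr_le1.
have gsort : sorted >=%R (map g r).
  rewrite sorted_map; apply/(sortedP 0) => i; rewrite rk => ik.
  have ik' := ltnW ik; rewrite /= /g ler_wpM2l ?spr_ge0 //.
  have := cinc (Ordinal ik') (Ordinal ik) (leqnSn i).
  have /andP[] := c01 (Ordinal ik); have /andP[] := c01 (Ordinal ik').
  by rewrite /c /=; nra.
rewrite {2}/sort_down (sorted_sort ge_trans gsort).
have [t tle] : exists t, j%:R * t + \sum_(i < k) Num.max (`|lX`_i - lY`_i| - t) 0 <=
    \sum_(l < k | (l < j)%N) spr lA / 2 * (2 * (1 - c l) + (1 - c l ^+ 2)).
  case: inv => [/(colspace_invariantE Xo)|/(colspace_invariantE Yo)].
    move=> /(colspace_invariantM Uo) inv.
    exact: (ritz_value_threshold XUo YVo XUYV inv Aa am m0 c01 cinc pn qn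
             (conjE _ _ _ Uo Xp) (conjE _ _ _ Vo Yq) jk).
  (* If the span of [Y] is invariant, [X] and [Y] swap roles: the Gram matrix is real diagonal,
     hence unchanged, and the absolute differences are symmetric. *)
  move=> /(colspace_invariantM Vo) inv.
  have [t tle] := ritz_value_threshold YVo XUo YVXU inv Aa am m0 c01 cinc qn pn
    (conjE _ _ _ Vo Yq) (conjE _ _ _ Uo Xp) jk.
  by exists t; under eq_bigr do rewrite distrC.
apply: le_trans (@sum_sort_down_le _ _ j t _) _; first by rewrite size_map zipk.
rewrite big_map (big_nth (0, 0)) zipk big_mkord.
under eq_bigr do rewrite nth_zip ?lXk ?lYk //=.
apply: le_trans tle _; rewrite le_eqVlt; apply/orP; left; apply/eqP.
rewrite -(big_ord_widen k
  (fun l => spr lA / 2 * (2 * (1 - r`_l) + (1 - r`_l ^+ 2))) jk).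
apply: eq_bigr => i _.
by rewrite (nth_map 0) ?rk ?(leq_trans (ltn_ord i)) // /g; field.
Qed.
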